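(* Let $\mathsf{H}$ be an almost hypercomplex structure on a smooth manifold $M$ of dimension $4n$. If there exist two almost complex structures $P, Q \in \mathsf{H}$ with $P \neq \pm Q$ which are both integrable, then every element of $\mathsf{H}$ is integrable.
   Context: An almost hypercomplex structure on a smooth manifold $M$ of real dimension $4n$ is a reduction of the structure group of $TM$ to $\mathrm{GL}(n,\mathbb{H})$; it is given by a triple $(I,J,K)$ of (globally defined) almost complex structures on $M$ satisfying $IJ=-JI=K$. The triple is not unique, but the associated 2-sphere of almost complex structures $\mathsf{H}=\{aI+bJ+cK \mid (a,b,c)\in S^2\}$ (with constant coefficients $a,b,c\in\mathbb{R}$) is uniquely determined by the structure, and the structure is identified with $\mathsf{H}$. An almost complex structure is integrable if it is induced by a complex manifold structure (equivalently, its Nijenhuis tensor vanishes). *)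

(* Defs.v *)
(* MathComp-Analysis, with R : realType as the real numbers.

   Smooth manifolds are Hausdorff second countable spaces with a C^oo atlas.
   Tangent vectors at p are the derivations at p of the algebra C^oo(M), and
   smooth vector fields are the fields of tangent vectors X such that X f is
   smooth for every smooth f.  A smooth field of endomorphisms of TM (a
   (1,1)-tensor field) is a family of linear endomorphisms of the tangent
   spaces that sends smooth vector fields to smooth vector fields.           *)
From HB Require Import structures.
From mathcomp Require Import all_boot all_order all_algebra.
From mathcomp Require Import all_classical all_reals all_analysis.
From mathcomp Require Import ring.
Import Order.TTheory GRing.Theory Num.Theory.
Import numFieldNormedType.Exports.

Set Implicit Arguments.
Unset Strict Implicit.
Unset Printing Implicit Defensive.

Local Open Scope classical_set_scope.
Local Open Scope ring_scope.

Section Differentiability.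
Context {R : realType} {m : nat}.
Implicit Types (U : set 'rV[R]_m) (f g : 'rV[R]_m -> R).

(* All iterated partial derivatives of f up to order k exist and are
   continuous on U; only meaningful when U is open. *)
Fixpoint Ck (k : nat) U f : Prop :=
  {in U, continuous f} /\
  if k is k'.+1 then
    forall i : 'I_m, {in U, forall x, derivable f x (delta_mx 0 i)} /\
                     Ck k' U (fun x => 'D_(delta_mx 0 i) f x)
  else True.

Definition smooth_on U f := forall k, Ck k U f.

Lemma in_open_near U f g x :
  open U -> {in U, f =1 g} -> x \in U -> \forall y \near x, f y = g y.
Proof.
move=> oU fg /set_mem xU.
by apply: filterS (open_nbhs_nbhs (conj oU xU)) => y /mem_set; exact: fg.
Qed.

Lemma Ck_eq k U f g : open U -> {in U, f =1 g} -> Ck k U f -> Ck k U g.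
Proof.
move=> oU.
have ceq (h h' : 'rV[R]_m -> R) : {in U, h =1 h'} -> {in U, continuous h} -> {in U, continuous h'}.
  move=> hh' ch x xU; have /= hx := ch x xU.
  rewrite /continuous_at -(hh' _ xU); apply: cvg_trans hx; apply: (@near_eq_cvg _ _ (nbhs x)).
  exact: in_open_near xU.
elim: k f g => [|k IH] f g fg [cf df]; split=> //;
  try exact: ceq fg cf.
move=> i; have [dfi Ci] := df i; split=> [x xU|].
  by apply: near_eq_derivable (dfi _ xU); exact: (in_open_near oU fg xU).
by apply: IH Ci => x xU; apply: near_eq_derive; exact: (in_open_near oU fg xU).
Qed.

Lemma Ck_continuous k U f : Ck k U f -> {in U, continuous f}.
Proof. by case: k => [|k] []. Qed.

Lemma CkS k U f : Ck k.+1 U f -> Ck k U f.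
Proof.
elim: k f => [|k IH] f [cf df]; split=> // i.
by have [dfi Ci] := df i; split => //; exact: IH.
Qed.

Lemma Ck_cst k U (a : R) : open U -> Ck k U (fun=> a).
Proof.
move=> oU; elim: k a => [|k IH] a; (split; first by move=> x _; exact: cst_continuous).
  by [].
move=> i; split=> [x _|]; first exact: derivable_cst.
by apply: (@Ck_eq _ _ (fun=> 0)) => // x _; rewrite derive_cst.
Qed.

Lemma CkD k U f g : open U -> Ck k U f -> Ck k U g -> Ck k U (f + g).
Proof.
move=> oU; elim: k f g => [|k IH] f g Cf Cg;
  (split; first by move=> x xU; apply: continuousD;
    [exact: (Ck_continuous Cf)|exact: (Ck_continuous Cg)]).
  by [].
move=> i; have [dfi Cfi] := Cf.2 i; have [dgi Cgi] := Cg.2 i; split=> [x xU|].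
  by apply: derivableD; [exact: dfi|exact: dgi].
apply: Ck_eq (IH _ _ Cfi Cgi) => // x xU.
by rewrite /= deriveD //; [exact: dfi|exact: dgi].
Qed.

Lemma CkM k U f g : open U -> Ck k U f -> Ck k U g -> Ck k U (f * g).
Proof.
move=> oU; elim: k f g => [|k IH] f g Cf Cg;
  (split; first by move=> x xU; apply: continuousM;
    [exact: (Ck_continuous Cf)|exact: (Ck_continuous Cg)]).
  by [].
move=> i; have [dfi Cfi] := Cf.2 i; have [dgi Cgi] := Cg.2 i; split=> [x xU|].
  by apply: derivableM; [exact: dfi|exact: dgi].
have := CkD oU (IH _ _ (CkS Cf) Cgi) (IH _ _ (CkS Cg) Cfi).
apply: Ck_eq => // x xU.
by rewrite /= deriveM //; [exact: dfi|exact: dgi].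
Qed.

End Differentiability.

(* A homeomorphism from the open set [dom] onto an open set of R^m; the values
   of [chart_map] and [chart_inv] outside [dom] and its image are junk. *)
Record chart (R : realType) (m : nat) (M : topologicalType) := Chart {
  dom : set M;
  chart_map :> M -> 'rV[R]_m;
  chart_inv : 'rV[R]_m -> M;
  dom_open : open dom;
  img_open : open (chart_map @` dom);
  chart_mapK : {in dom, cancel chart_map chart_inv};
  chart_map_continuous : {in dom, continuous chart_map};
  chart_inv_continuous : {in chart_map @` dom, continuous chart_inv} }.

Definition smooth_transition (R : realType) (m : nat) (M : topologicalType)
    (c d : chart R m M) :=
  forall j, smooth_on (c @` (dom c `&` dom d)) (fun x => d (chart_inv c x) 0 j).

Record smoothManifold (R : realType) (m : nat) := SmoothManifold {
  points :> topologicalType;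
  manifold_hausdorff : hausdorff_space points;
  manifold_second_countable : @second_countable points;
  atlas : set (chart R m points);
  atlas_cover : forall p : points, exists2 c, atlas c & dom c p;
  atlas_smooth : forall c d, atlas c -> atlas d -> smooth_transition c d }.

Section SmoothFunctions.
Context {R : realType} {m : nat} (M : smoothManifold R m).

Definition smooth (f : M -> R) :=
  forall c, atlas c -> smooth_on (c @` dom c) (f \o chart_inv c).

Definition smooth_pred : {pred M -> R} := mem [set f | smooth f].

Lemma smooth_subring : subring_closed smooth_pred.
Proof.
have sc a : smooth (fun=> a) by move=> c _ k; apply: Ck_cst; exact: img_open.
have sM f g : smooth f -> smooth g -> smooth (f * g).
  by move=> sf sg c Ac k; exact: (CkM (@img_open _ _ _ c) (sf c Ac k) (sg c Ac k)).
split=> [|f g /set_mem sf /set_mem sg|f g /set_mem sf /set_mem sg];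
  apply/mem_set; [exact: sc| |exact: sM].
move=> c Ac k; have oc := @img_open _ _ _ c.
have := CkD oc (sf c Ac k) (CkM oc (Ck_cst k (-1) oc) (sg c Ac k)).
by apply: Ck_eq => // x _; rewrite -[LHS]/(f _ + -1 * g _) mulN1r.
Qed.

Lemma smooth_scaler : GRing.scaler_closed smooth_pred.
Proof.
move=> a f /set_mem sf; apply/mem_set => c Ac k.
have oc := @img_open _ _ _ c.
exact: (CkM oc (Ck_cst k a oc) (sf c Ac k)).
Qed.

HB.instance Definition _ :=
  GRing.isSubringClosed.Build (M -> R) smooth_pred smooth_subring.
HB.instance Definition _ :=
  GRing.isScaleClosed.Build R (M -> R) smooth_pred smooth_scaler.

Record smoothfun := Smoothfun {
  smoothfun_val :> M -> R;
  smoothfunP : smooth_pred smoothfun_val }.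

HB.instance Definition _ := [isSub of smoothfun for smoothfun_val].
HB.instance Definition _ := [Choice of smoothfun by <:].
HB.instance Definition _ := 
  GRing.SubChoice_isSubComPzRing.Build _ _ smoothfun (subringClosedP _).
HB.instance Definition _ := [SubZmodule_isSubLmodule of smoothfun by <:].

End SmoothFunctions.

Section TangentSpaces.
Context {R : realType} {m : nat} (M : smoothManifold R m).
Local Notation C := (smoothfun M).

Definition derivation_at (p : M) (v : C -> R) :=
  scalar v /\ forall f g : C, v (f * g) = v f * g p + f p * v g.

Definition derivation_at_pred (p : M) : {pred C -> R} :=
  mem [set v | derivation_at p v].

Lemma derivation_at_submod (p : M) : submod_closed (derivation_at_pred p).
Proof.
split=> [|a v w /set_mem[lv dv] /set_mem[lw dw]]; apply/mem_set; split.
- by move=> a f g; rewrite mulr0 addr0.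
- by move=> f g; rewrite mul0r mulr0 addr0.
- move=> b f g; rewrite -![(a *: v + w) _]/(a * v _ + w _) lv lw.
  by rewrite !mulrDr addrACA !mulrA (mulrC a b).
- move=> f g; rewrite -![(a *: v + w) _]/(a * v _ + w _) dv dw.
  by rewrite !mulrDr mulrDl addrACA !mulrA (mulrC a (f p)).
Qed.

HB.instance Definition _ p :=
  GRing.isSubmodClosed.Build R (C -> R) (derivation_at_pred p)
    (derivation_at_submod p).

Record tangent (p : M) := Tangent {
  tangent_val :> C -> R;
  tangentP : derivation_at_pred p tangent_val }.

HB.instance Definition _ p := [isSub of tangent p for @tangent_val p].
HB.instance Definition _ p := [Choice of tangent p by <:].
HB.instance Definition _ p := [SubChoice_isSubZmodule of tangent p by <:].
HB.instance Definition _ p := [SubZmodule_isSubLmodule of tangent p by <:].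

End TangentSpaces.

Section VectorFields.
Context {R : realType} {m : nat} (M : smoothManifold R m).
Local Notation C := (smoothfun M).

Record vfield := Vfield {
  vfield_val :> forall p : M, tangent p;
  vfield_smooth : forall f : C, smooth (fun p => vfield_val p f) }.

Definition vfield_app (X : vfield) (f : C) : C :=
  Smoothfun (mem_set (vfield_smooth X f)).

Definition lie_bracket_at (X Y : vfield) (p : M) (f : C) : R :=
  X p (vfield_app Y f) - Y p (vfield_app X f).

Lemma lie_bracket_derivation X Y p :
  derivation_at_pred p (lie_bracket_at X Y p).
Proof.
have appL (Z : vfield) : linear (vfield_app Z).
  move=> a f g; apply/val_inj/funext => q /=.
  by rewrite (set_mem (tangentP (Z q))).1.
have appM (Z : vfield) f g :
    vfield_app Z (f * g) = vfield_app Z f * g + f * vfield_app Z g.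
  by apply/val_inj/funext => q /=; rewrite (set_mem (tangentP (Z q))).2.
have addE (v : tangent p) (f g : C) : v (f + g) = v f + v g.
  by rewrite -[f in LHS]scale1r (set_mem (tangentP v)).1 mul1r.
apply/mem_set; split=> [a f g|f g]; rewrite /lie_bracket_at.
  rewrite !appL !(set_mem (tangentP _)).1 opprD addrACA.
  by rewrite mulrBr.
rewrite !appM !addE !(set_mem (tangentP _)).2 /=.
ring.
Qed.

Lemma lie_bracket_smooth X Y f : smooth (fun p => lie_bracket_at X Y p f).
Proof.
exact: (set_mem (smoothfunP (vfield_app X (vfield_app Y f)
                             - vfield_app Y (vfield_app X f)))).
Qed.

Definition lie_bracket (X Y : vfield) : vfield :=
  @Vfield (fun p => Tangent (lie_bracket_derivation X Y p))
    (@lie_bracket_smooth X Y).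

End VectorFields.

Section Endomorphisms.
Context {R : realType} {m : nat} (M : smoothManifold R m).
Local Notation C := (smoothfun M).

Record endo := Endo {
  endo_val :> forall p : M, tangent p -> tangent p;
  endo_linear : forall p, linear (@endo_val p);
  endo_smooth : forall (X : vfield M) (f : C),
    smooth (fun p => endo_val (X p) f) }.

Lemma endo_eq (A B : endo) : (forall p (v : tangent p), A p v = B p v) -> A = B.
Proof.
case: A B => A lA sA [B lB sB] /= AB.
have E : A = B by apply/functional_extensionality_dep => p; exact/funext/AB.
by rewrite {}E in lA sA *; congr Endo; exact: Prop_irrelevance.
Qed.

Definition endo_app (A : endo) (X : vfield M) : vfield M :=
  @Vfield _ _ _ (fun p => A p (X p)) (endo_smooth A X).

Lemma id_endo_smooth (X : vfield M) (f : C) : smooth (fun p => X p f).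
Proof. exact: vfield_smooth. Qed.

Definition id_endo : endo :=
  @Endo (fun _ v => v) (fun _ _ _ _ => erefl) id_endo_smooth.

Lemma comp_endo_linear (A B : endo) p : linear (A p \o B p).
Proof. by move=> a v w; rewrite /= !endo_linear. Qed.

Lemma comp_endo_smooth (A B : endo) (X : vfield M) (f : C) :
  smooth (fun p => (A p \o B p) (X p) f).
Proof. exact: (endo_smooth A (endo_app B X)). Qed.

Definition comp_endo (A B : endo) : endo :=
  Endo (comp_endo_linear A B) (@comp_endo_smooth A B).

Lemma zero_endo_linear (p : M) :
  linear (fun _ : tangent p => 0 : tangent p).
Proof. by move=> a v w; rewrite scaler0 addr0. Qed.

Lemma zero_endo_smooth (X : vfield M) (f : C) :
  smooth (fun p => (0 : tangent p) f).
Proof. exact: (set_mem (smoothfunP (0 : C))). Qed.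

Definition zero_endo : endo := Endo zero_endo_linear zero_endo_smooth.

Lemma opp_endo_linear (A : endo) p : linear (fun v : tangent p => - A p v).
Proof. by move=> a v w; rewrite endo_linear opprD scalerN. Qed.

Lemma opp_endo_smooth (A : endo) (X : vfield M) (f : C) :
  smooth (fun p => (- A p (X p)) f).
Proof. exact: (set_mem (smoothfunP (- vfield_app (endo_app A X) f))). Qed.

Definition opp_endo (A : endo) : endo :=
  Endo (opp_endo_linear A) (@opp_endo_smooth A).

Lemma add_endo_linear (A B : endo) p :
  linear (fun v : tangent p => A p v + B p v).
Proof. by move=> a v w; rewrite !endo_linear scalerDr addrACA. Qed.

Lemma add_endo_smooth (A B : endo) (X : vfield M) (f : C) :
  smooth (fun p => (A p (X p) + B p (X p)) f).
Proof.
exact: (set_mem (smoothfunP (vfield_app (endo_app A X) f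
                             + vfield_app (endo_app B X) f))).
Qed.

Definition add_endo (A B : endo) : endo :=
  Endo (add_endo_linear A B) (@add_endo_smooth A B).

Lemma scale_endo_linear (a : R) (A : endo) p :
  linear (fun v : tangent p => a *: A p v).
Proof.
by move=> b v w; rewrite endo_linear scalerDr !scalerA mulrC.
Qed.

Lemma scale_endo_smooth (a : R) (A : endo) (X : vfield M) (f : C) :
  smooth (fun p => (a *: A p (X p)) f).
Proof. exact: (set_mem (smoothfunP (a *: vfield_app (endo_app A X) f))). Qed.

Definition scale_endo (a : R) (A : endo) : endo :=
  Endo (scale_endo_linear a A) (@scale_endo_smooth a A).

HB.instance Definition _ := gen_eqMixin endo.
HB.instance Definition _ := gen_choiceMixin endo.

Lemma add_endoA : associative add_endo.
Proof. by move=> A B D; apply: endo_eq => p v; exact: addrA. Qed.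

Lemma add_endoC : commutative add_endo.
Proof. by move=> A B; apply: endo_eq => p v; exact: addrC. Qed.

Lemma add_0endo : left_id zero_endo add_endo.
Proof. by move=> A; apply: endo_eq => p v; exact: add0r. Qed.

Lemma add_Nendo : left_inverse zero_endo opp_endo add_endo.
Proof. by move=> A; apply: endo_eq => p v; exact: addNr. Qed.

HB.instance Definition _ :=
  GRing.isZmodule.Build endo add_endoA add_endoC add_0endo add_Nendo.

Lemma scale_endoA a b (A : endo) :
  scale_endo a (scale_endo b A) = scale_endo (a * b) A.
Proof. by apply: endo_eq => p v; exact: scalerA. Qed.

Lemma scale_1endo : left_id 1 scale_endo.
Proof. by move=> A; apply: endo_eq => p v; exact: scale1r. Qed.

Lemma scale_endoDr : right_distributive scale_endo +%R.
Proof. by move=> a A B; apply: endo_eq => p v; exact: scalerDr. Qed.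

Lemma scale_endoDl (A : endo) : {morph scale_endo^~ A : a b / a + b}.
Proof. by move=> a b; apply: endo_eq => p v; exact: scalerDl. Qed.

HB.instance Definition _ := GRing.Zmodule_isLmodule.Build R endo
  scale_endoA scale_1endo scale_endoDr scale_endoDl.

Definition almost_complex (J : endo) := comp_endo J J = - id_endo.

Definition nijenhuis (J : endo) (X Y : vfield M) (p : M) : tangent p :=
  lie_bracket X Y p
  + J p (lie_bracket (endo_app J X) Y p + lie_bracket X (endo_app J Y) p)
  - lie_bracket (endo_app J X) (endo_app J Y) p.

(* By the Newlander-Nirenberg theorem, an almost complex structure is induced
   by a complex manifold structure exactly when its Nijenhuis tensor vanishes;
   the latter is taken as the definition. *)
Definition acs_integrable (J : endo) :=
  almost_complex J /\ forall X Y p, nijenhuis J X Y p = 0.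

Definition sphere_of (I J K : endo) : set endo :=
  [set A | exists a b c : R,
    a ^+ 2 + b ^+ 2 + c ^+ 2 = 1 /\ A = a *: I + b *: J + c *: K].

(* The structure is identified with its 2-sphere H; the triple (I, J, K)
   generating it is not unique. *)
Definition almost_hypercomplex (H : set endo) :=
  exists I J K : endo,
    [/\ almost_complex I, almost_complex J, almost_complex K,
        comp_endo I J = K /\ comp_endo J I = - K & H = sphere_of I J K].

End Endomorphisms.

Arguments endo {R m} M.

(* Main.v *)
Require Import Defs.
From HB Require Import structures.
From mathcomp Require Import all_boot all_order all_algebra.
From mathcomp Require Import all_classical all_reals all_analysis.
From mathcomp Require Import ring.
Import GRing.Theory Num.Theory.
Local Open Scope classical_set_scope.
Local Open Scope ring_scope.

(** The theorem is linear algebra in one real vector space V, the space of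
    vector fields, which carries a bilinear bracket and linear maps I, J, K
    satisfying the quaternion relations.

    Let I and J be anticommuting almost complex structures, let V+ and V- be
    the eigenspaces of I in the complexification of V, so that J exchanges
    them, and suppose that I is integrable, which means that V+ and V- are
    closed under the bracket.  An eigenspace of a member of the sphere other
    than I and -I is a graph { x + l J x | x in V+ }.  With
    [Jx, y] + [x, Jy] = b+ + b-, the bracket of x + l J x and y + l J y is
        ([x, y] + l b+) + (l b- + l^2 [Jx, Jy]),
    and the graph is closed under the bracket exactly when
        (J[x, y] - b-) + l (J b+ - [Jx, Jy]) = 0.
    This affine equation in l is satisfied for both eigenspaces of a second
    integrable structure, hence for every l, and then every member of the
    sphere is integrable.

    The proof below is this argument with real scalars.  The torsion of
    a I + b J + c K is a quadratic expression in (a, b, c) (torsion_comb), with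
    the bilinear concomitants [mixed] as off-diagonal terms.  If c I + s J is
    integrable along with I, and s <> 0, then s N_J = - c mixed(I, J).  The two
    sides have different symmetries under I and J (torsion_twistl,
    mixed_twistl and their right-hand versions), and a map with all these
    symmetries is zero (antilinear_eq0): thus N_J = 0, and then mixed(I, J) = 0
    (torsion_mixed_eq0).  The terms that involve K = IJ are combinations of
    N_I, N_J and mixed(I, J) (mixed_comp, torsion_comp), so the whole quadratic
    expression vanishes (torsion_sphere_eq0).  Two arbitrary distinct
    non-opposite unit imaginary quaternions reduce to an orthonormal pair by
    Gram-Schmidt (imq_torsion_eq0). *)

(** * Cancellation in commutative groups *)

(* The summands become variables before the search for opposite pairs:
   comparing linear expressions up to conversion would be much too slow. *)
Ltac abstract_atom t :=
  lazymatch t with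
  | - ?u => abstract_atom u
  | 0 => idtac
  | _ => tryif is_var t then idtac else (let z := fresh "z" in set z := t; clearbody z)
  end.

Ltac abstract_atoms t :=
  lazymatch t with
  | ?u + ?v => abstract_atom v; abstract_atoms u
  | _ => idtac
  end.

(* Moves the opposite of the last summand next to it and cancels the pair. *)
Ltac cancel_step :=
  lazymatch goal with
  | |- 0 = 0 => reflexivity
  | |- _ - ?x = 0 => repeat rewrite (addrAC _ x); rewrite addrNK
  | |- _ + ?x = 0 => repeat rewrite (addrAC _ (- x)); rewrite addrK
  end.

Ltac zmod_cancel :=
  apply/eqP; rewrite -subr_eq0; apply/eqP; rewrite -[LHS]add0r;
  rewrite ?opprD ?opprK ?addrA;
  lazymatch goal with |- ?t = 0 => abstract_atoms t end;
  repeat cancel_step.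

(** * The torsion of an operator for a bilinear bracket *)

(** For A the action of an almost complex structure on vector fields this is
    its Nijenhuis tensor. *)
Definition torsion {V : zmodType} (br : V -> V -> V) (A : V -> V) x y :=
  br x y + A (br (A x) y + br x (A y)) - br (A x) (A y).

(** The polarisation of the part of the torsion that is quadratic in A. *)
Definition mixed {V : zmodType} (br : V -> V -> V) (A B : V -> V) x y :=
  A (br (B x) y + br x (B y)) + B (br (A x) y + br x (A y))
  - (br (A x) (B y) + br (B x) (A y)).

Section TorsionCalculus.
Context {R : comNzRingType} {V : lmodType R} {br : V -> V -> V}.
Context (brl : forall y, linear (br^~ y)) (brr : forall x, linear (br x)).
Local Notation torsion := (torsion br).
Local Notation mixed := (mixed br).

Lemma brDl x x' y : br (x + x') y = br x y + br x' y.
Proof. by have := brl y 1 x x'; rewrite /= !scale1r. Qed.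
Lemma brDr x y y' : br x (y + y') = br x y + br x y'.
Proof. by have := brr x 1 y y'; rewrite /= !scale1r. Qed.
Lemma br0l y : br 0 y = 0.
Proof. by apply: (addIr (br 0 y)); rewrite -brDl !add0r. Qed.
Lemma br0r x : br x 0 = 0.
Proof. by apply: (addIr (br x 0)); rewrite -brDr !add0r. Qed.
Lemma brZl a x y : br (a *: x) y = a *: br x y.
Proof. by have := brl y a x 0; rewrite /= br0l !addr0. Qed.
Lemma brZr a x y : br x (a *: y) = a *: br x y.
Proof. by have := brr x a y 0; rewrite /= br0r !addr0. Qed.
Lemma brNl x y : br (- x) y = - br x y.
Proof. by rewrite -scaleN1r brZl scaleN1r. Qed.
Lemma brNr x y : br x (- y) = - br x y.
Proof. by rewrite -scaleN1r brZr scaleN1r. Qed.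

Definition brE := (brDl, brDr, brNl, brNr, brZl, brZr).

(** For a unit (a, b, c) the bracket itself drops out, so torsions and mixed
    terms alone decide integrability on the sphere. *)
Lemma torsion_comb (I J K : {linear V -> V}) {A : V -> V} {a b c} :
  (forall v, A v = a *: I v + b *: J v + c *: K v) -> forall x y,
  torsion A x y = (1 - (a ^+ 2 + b ^+ 2 + c ^+ 2)) *: br x y
    + (a ^+ 2 *: torsion I x y + b ^+ 2 *: torsion J x y + c ^+ 2 *: torsion K x y)
    + ((a * b) *: mixed I J x y + (a * c) *: mixed I K x y + (b * c) *: mixed J K x y).
Proof.
move=> AE x y; rewrite /torsion /mixed !AE.
rewrite !(brE, linearD I, linearD J, linearD K, linearZ_LR I, linearZ_LR J, linearZ_LR K).
rewrite !(scalerDr, scalerN, scalerDl, scaleNr, scalerA, scale1r, expr2).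
rewrite (mulrC b a) (mulrC c a) (mulrC c b).
zmod_cancel.
Qed.

Section AnticommutingPair.
Context {I J : {linear V -> V}}.
Context (II : forall v, I (I v) = - v) (JI : forall v, J (I v) = - I (J v)).

Lemma torsion_twistl x y : torsion I (I x) y = - I (torsion I x y).
Proof. by rewrite /torsion !(linearD I, linearN I, II, brE) /=; zmod_cancel. Qed.

Lemma torsion_twistr x y : torsion I x (I y) = - I (torsion I x y).
Proof. by rewrite /torsion !(linearD I, linearN I, II, brE) /=; zmod_cancel. Qed.

(** When I is integrable, the mixed term inherits the symmetry under I that
    the torsion of I always has. *)
Lemma mixed_twistl x y : mixed I J (I x) y =
  - I (mixed I J x y) - torsion I (J x) y - J (torsion I x y).
Proof.
rewrite /torsion /mixed !(linearD I, linearN I, linearD J, linearN J, II, JI, brE) /=.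
zmod_cancel.
Qed.

Lemma mixed_twistr x y : mixed I J x (I y) =
  - I (mixed I J x y) - torsion I x (J y) - J (torsion I x y).
Proof.
rewrite /torsion /mixed !(linearD I, linearN I, linearD J, linearN J, II, JI, brE) /=.
zmod_cancel.
Qed.

(** On two vectors of the same type for I, say in V+, IJ is a multiple of J,
    which makes the two mixed terms proportional; on vectors of different type
    both vanish when I is integrable. *)
Lemma mixed_comp x y : mixed I (I \o J) x y =
  I (mixed I J x y) + torsion I (J x) y + torsion I x (J y).
Proof. by rewrite /torsion /mixed /= !(linearD I, linearN I, II, brE) /=; zmod_cancel. Qed.

Context (JJ : forall v, J (J v) = - v).

(** For integrable I, on V+ x V+ the components of the torsion of J in V+ and
    V- are -JD and E, with D = J[x, y] - b- and E = J b+ - [Jx, Jy], and those of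
    the torsion of IJ are -JD and -E; the mixed term is 2iD.  Evaluating N_J at
    (Ix, Iy) reverses the sign on vectors of the same type only, and the mixed
    term then corrects the part in V+. *)
Lemma torsion_comp x y : torsion (I \o J) x y =
  torsion J (I x) (I y) + I (J (mixed I J x y)) + torsion I x y
  - J (torsion I (J x) y) - J (torsion I x (J y)).
Proof.
by rewrite /torsion /mixed /= !(linearD I, linearN I, linearD J, linearN J, II, JI, JJ, brE) /=; zmod_cancel.
Qed.

End AnticommutingPair.
End TorsionCalculus.

(** * Two anticommuting integrable structures *)

Section IntegrablePair.
Context {R : numFieldType} {V : lmodType R} {br : V -> V -> V}.
Context (brl : forall y, linear (br^~ y)) (brr : forall x, linear (br x)).
Local Notation torsion := (torsion br).
Local Notation mixed := (mixed br).
Context {I J : {linear V -> V}}.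
Context (II : forall v, I (I v) = - v) (JJ : forall v, J (J v) = - v).
Context (JI : forall v, J (I v) = - I (J v)).

(** Computing f (IJx) (IJy) by moving out I from both slots and then J gives
    f x y; moving out IJ from each slot in turn gives (IJ)^2 (f x y), the
    opposite. *)
Lemma antilinear_eq0 (f : V -> V -> V) :
  (forall x y, f (I x) y = - I (f x y)) -> (forall x y, f x (I y) = - I (f x y)) ->
  (forall x y, f (J x) y = - J (f x y)) -> (forall x y, f x (J y) = - J (f x y)) ->
  forall x y, f x y = 0.
Proof.
move=> fIl fIr fJl fJr x y.
have E1 : f (I (J x)) (I (J y)) = f x y.
  by rewrite fIl fIr fJl fJr !(linearN I, linearN J, opprK, II, JJ).
have E2 : f (I (J x)) (I (J y)) = - f x y.
  by rewrite fIl fJl fIr fJr !(linearN I, linearN J, opprK, JI, II, JJ).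
have /eqP: 2%:R *: f x y = 0 by rewrite scaler_nat mulr2n -{1}E1 E2 addNr.
by rewrite scaler_eq0 pnatr_eq0 => /eqP.
Qed.

Lemma mixedC A B x y : mixed A B x y = mixed B A x y.
Proof.
by rewrite /mixed [X in X - _]addrC; congr (_ - _); rewrite addrC.
Qed.

Lemma mixedNr (A : {linear V -> V}) (B B' : V -> V) x y :
  (forall v, B' v = - B v) -> mixed A B' x y = - mixed A B x y.
Proof.
move=> E; rewrite /mixed !E.
rewrite !(brNl brl, brNr brr, linearD A, linearN A).
zmod_cancel.
Qed.

(** The hypothesis on s and c is the integrability of c I + s J divided by s.
    It makes N_J proportional to mixed(I, J), so that N_J has the symmetry of
    the latter under I besides its own under J; once N_J = 0, the mixed term has
    both symmetries as well, because the roles of I and J can be exchanged. *)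
Lemma torsion_mixed_eq0 {s c : R} : s != 0 ->
  (forall x y, torsion I x y = 0) ->
  (forall x y, s *: torsion J x y + c *: mixed I J x y = 0) ->
  (forall x y, torsion J x y = 0) /\ (forall x y, mixed I J x y = 0).
Proof.
move=> s0 tI tQ.
have IJ v : I (J v) = - J (I v) by rewrite JI opprK.
have tJ : forall x y, torsion J x y = 0.
  have tJE x y : torsion J x y = - (s^-1 * c) *: mixed I J x y.
    apply: (scalerI s0); rewrite -[LHS](addrK (c *: mixed I J x y)) tQ.
    by rewrite scalerA mulrN mulVKf// sub0r scaleNr.
  apply: antilinear_eq0 => x y; [| | exact: torsion_twistl | exact: torsion_twistr].
    rewrite !tJE (mixed_twistl brl II JI) !tI (linear0 J) !subr0.
    by rewrite linearZ_LR scalerN.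
  rewrite !tJE (mixed_twistr brr II JI) !tI (linear0 J) !subr0.
  by rewrite linearZ_LR scalerN.
split=> //; apply: antilinear_eq0 => x y.
- by rewrite (mixed_twistl brl II JI) !tI (linear0 J) !subr0.
- by rewrite (mixed_twistr brr II JI) !tI (linear0 J) !subr0.
- by rewrite ![mixed I J _ _]mixedC (mixed_twistl brl JJ IJ) !tJ (linear0 I) !subr0.
- by rewrite ![mixed I J _ _]mixedC (mixed_twistr brr JJ IJ) !tJ (linear0 I) !subr0.
Qed.

Lemma torsion_sphere_eq0 {A : V -> V} {a b c : R} : a ^+ 2 + b ^+ 2 + c ^+ 2 = 1 ->
  (forall v, A v = a *: I v + b *: J v + c *: I (J v)) ->
  (forall x y, torsion I x y = 0) -> (forall x y, torsion J x y = 0) ->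
  (forall x y, mixed I J x y = 0) ->
  forall x y, torsion A x y = 0.
Proof.
move=> abc1 AE tI tJ mIJ x y.
have IJ v : I (J v) = - J (I v) by rewrite JI opprK.
have tK : torsion (I \o J) x y = 0.
  by rewrite (torsion_comp brl brr II JI JJ) !(tI, tJ, mIJ, linear0 I, linear0 J) !(addr0, subr0).
have mIK : mixed I (I \o J) x y = 0.
  by rewrite (mixed_comp II) !(tI, mIJ, linear0 I) !addr0.
have mJK : mixed J (I \o J) x y = 0.
  rewrite (@mixedNr J (J \o I)) => [|v]; last exact: IJ.
  by rewrite (mixed_comp JJ) mixedC !(tJ, mIJ, linear0 I, linear0 J) !addr0 oppr0.
rewrite (torsion_comb brl brr I J (I \o J) AE).
by rewrite abc1 subrr scale0r !(tI, tJ, tK, mIJ, mIK, mJK, scaler0) !addr0.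
Qed.
End IntegrablePair.

(** * Imaginary quaternions acting on a module *)

Section ImaginaryQuaternions.
Context {R : comNzRingType}.
Implicit Types u w a : R * R * R.

Definition dot u w := u.1.1 * w.1.1 + u.1.2 * w.1.2 + u.2 * w.2.

Definition cross u w :=
  (u.1.2 * w.2 - u.2 * w.1.2, u.2 * w.1.1 - u.1.1 * w.2, u.1.1 * w.1.2 - u.1.2 * w.1.1).

(** The orthonormal triple u, w, u x w is a basis.  The polynomial identity is
    the Cauchy-Binet (Gram determinant) formula for the triple (u, w, a). *)
Lemma cross_parseval {u w} a : dot u u = 1 -> dot w w = 1 -> dot u w = 0 ->
  dot a u ^+ 2 + dot a w ^+ 2 + dot a (cross u w) ^+ 2 = dot a a.
Proof.
move=> uu ww uw.
have : (dot u u * dot w w - dot u w ^+ 2) * dot a a =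
    dot w w * dot a u ^+ 2 - 2 * dot u w * dot a u * dot a w
    + dot u u * dot a w ^+ 2 + dot a (cross u w) ^+ 2.
  by rewrite /dot /cross /=; ring.
by rewrite uu ww uw => E; rewrite -[RHS]mul1r; ring: E.
Qed.

Context {V : lmodType R}.
Definition imq (I J K : V -> V) u v := u.1.1 *: I v + u.1.2 *: J v + u.2 *: K v.

Lemma imq_comb (I J K : V -> V) x y z u w k a :
  a = (x * u.1.1 + y * w.1.1 + z * k.1.1, x * u.1.2 + y * w.1.2 + z * k.1.2,
       x * u.2 + y * w.2 + z * k.2) ->
  forall v, imq I J K a v =
    x *: imq I J K u v + y *: imq I J K w v + z *: imq I J K k v.
Proof.
move=> -> v; rewrite /imq /= !(scalerDl, scalerDr, scalerA); zmod_cancel.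
Qed.

(** Cramer's rule for the triple u, w, u x w, whose determinant |u x w|^2 is 1
    by Lagrange's identity. *)
Lemma cross_expansion (I J K : V -> V) {u w} a :
  dot u u = 1 -> dot w w = 1 -> dot u w = 0 -> forall v,
  imq I J K a v = dot a u *: imq I J K u v + dot a w *: imq I J K w v
                + dot a (cross u w) *: imq I J K (cross u w) v.
Proof.
move=> uu ww uw; apply: imq_comb.
(* g is |u x w|^2 and g a = x u + y w + z k holds for arbitrary u and w. *)
pose g := dot u u * dot w w - dot u w ^+ 2.
pose x := dot w w * dot a u - dot u w * dot a w.
pose y := dot u u * dot a w - dot u w * dot a u.
pose z := dot a (cross u w); pose k := cross u w.
have g1 : g = 1 by rewrite /g uu ww uw; ring.
have <- : x = dot a u by rewrite /x ww uw; ring.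
have <- : y = dot a w by rewrite /y uu uw; ring.
rewrite -/z -/k [LHS]surjective_pairing [a.1]surjective_pairing.
by congr (_, _, _); rewrite -[LHS]mul1r -g1 /g /x /y /z /k /dot /cross /=; ring.
Qed.

Context {I J K : {linear V -> V}}.
Context (II : forall v, I (I v) = - v) (JJ : forall v, J (J v) = - v).
Context (IJ : forall v, I (J v) = K v) (JI : forall v, J (I v) = - K v).

Fact imq_linear u : linear (imq I J K u).
Proof.
move=> a x y; rewrite /imq (linearP I) (linearP J) (linearP K) !scalerDr !scalerA !(mulrC _ a); zmod_cancel.
Qed.

HB.instance Definition _ u := GRing.isLinear.Build R V V *:%R (imq I J K u) (imq_linear u).

(** The product of two imaginary quaternions. *)
Lemma imq_comp u w v :
  imq I J K u (imq I J K w v) = - dot u w *: v + imq I J K (cross u w) v.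
Proof.
have IK x : I (K x) = - J x by rewrite -IJ II.
have KI x : K (I x) = J x by rewrite -IJ JI linearN IK opprK.
have KJ x : K (J x) = - I x by rewrite -IJ JJ linearN.
have JK x : J (K x) = I x by rewrite -IJ JI KJ opprK.
have KK x : K (K x) = - x by rewrite -{1}IJ JK II.
rewrite /imq /dot /=.
rewrite !(linearD I, linearD J, linearD K, linearZ_LR I, linearZ_LR J, linearZ_LR K).
rewrite !(II, JJ, KK, IJ, JI, IK, KI, JK, KJ).
rewrite !(scalerDr, scalerDl, scalerN, scaleNr, scalerA).
zmod_cancel.
Qed.

Lemma imq_unit u v : dot u u = 1 -> imq I J K u (imq I J K u v) = - v.
Proof.
move=> uu; rewrite imq_comp uu scaleN1r /imq /cross /=.
by rewrite (mulrC u.2 u.1.2) (mulrC u.2 u.1.1) (mulrC u.1.2 u.1.1) !subrr !scale0r !addr0.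
Qed.

Lemma imq_orthogonal u w v : dot u w = 0 ->
  imq I J K u (imq I J K w v) = imq I J K (cross u w) v.
Proof. by move=> uw; rewrite imq_comp uw oppr0 scale0r add0r. Qed.

Lemma imq_anticomm u w v : dot u w = 0 ->
  imq I J K w (imq I J K u v) = - imq I J K u (imq I J K w v).
Proof.
move=> uw; have wu : dot w u = 0 by rewrite -uw /dot; ring.
rewrite !imq_orthogonal// /imq /cross /= !opprD -!scaleNr.
by congr (_ *: _ + _ *: _ + _ *: _); ring.
Qed.
End ImaginaryQuaternions.

(** * From two points of the sphere to the whole sphere *)

Section SphereTorsion.
Context {R : rcfType} {V : lmodType R} {br : V -> V -> V}.
Context (brl : forall y, linear (br^~ y)) (brr : forall x, linear (br x)).
Context {I J K : {linear V -> V}}.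
Context (II : forall v, I (I v) = - v) (JJ : forall v, J (J v) = - v).
Context (IJ : forall v, I (J v) = K v) (JI : forall v, J (I v) = - K v).
Local Notation imq := (imq I J K).
Local Notation torsion := (torsion br).
Local Notation mixed := (mixed br).

Lemma gram_schmidt {p q : R * R * R} : dot p p = 1 -> dot q q = 1 ->
  q <> p -> q <> (- p.1.1, - p.1.2, - p.2) ->
  exists (s : R) (j : R * R * R), [/\ s != 0, dot j j = 1, dot p j = 0, dot p q ^+ 2 + s ^+ 2 = 1 &
    q = (dot p q * p.1.1 + s * j.1.1, dot p q * p.1.2 + s * j.1.2, dot p q * p.2 + s * j.2)].
Proof.
move: p q => [[p1 p2] p3] [[q1 q2] q3].
set p := (p1, p2, p3); set q := (q1, q2, q3); set c := dot p q => pp qq qp qNp.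
pose r1 := q1 - c * p1; pose r2 := q2 - c * p2; pose r3 := q3 - c * p3.
have rr : r1 ^+ 2 + r2 ^+ 2 + r3 ^+ 2 = 1 - c ^+ 2.
  have : r1 ^+ 2 + r2 ^+ 2 + r3 ^+ 2 = dot q q - 2 * c * dot p q + c ^+ 2 * dot p p.
    by rewrite /r1 /r2 /r3 /dot /=; ring.
  by rewrite pp qq -/c => ->; ring.
have c2 : 0 <= 1 - c ^+ 2 by rewrite -rr !addr_ge0 ?sqr_ge0.
pose s := Num.sqrt (1 - c ^+ 2).
have s2 : s ^+ 2 = 1 - c ^+ 2 by rewrite sqr_sqrtr.
have s0 : s != 0.
  (* s = 0 would make q = c p with c = 1 or c = -1. *)
  apply/eqP => s0; move: s2; rewrite s0 expr0n /= => /esym c1.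
  move: rr; rewrite c1 => /eqP.
  rewrite !paddr_eq0 ?addr_ge0 ?sqr_ge0// !sqrf_eq0 !subr_eq0.
  move=> /andP[/andP[/eqP q1E /eqP q2E] /eqP q3E].
  move/eqP: c1; rewrite subr_eq0 eq_sym sqrf_eq1 => /orP[]/eqP cE.
    by apply: qp; rewrite /q q1E q2E q3E cE !mul1r.
  by apply: qNp; rewrite /q q1E q2E q3E cE !mulN1r.
exists s, (s^-1 * r1, s^-1 * r2, s^-1 * r3); split=> //.
- have -> : dot (s^-1 * r1, s^-1 * r2, s^-1 * r3) (s^-1 * r1, s^-1 * r2, s^-1 * r3)
      = (s ^+ 2)^-1 * (r1 ^+ 2 + r2 ^+ 2 + r3 ^+ 2).
    by rewrite /dot /=; field.
  by rewrite rr -s2 mulVf// sqrf_eq0.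
- have -> : dot p (s^-1 * r1, s^-1 * r2, s^-1 * r3) = s^-1 * (dot p q - c * dot p p).
    by rewrite /r1 /r2 /r3 /dot /=; ring.
  by rewrite pp mulr1 subrr mulr0.
- by rewrite s2 subrKC.
- by rewrite /= !mulVKf// !subrKC.
Qed.

(** p and the j of Gram-Schmidt form an anticommuting pair, and every point
    of the sphere is a combination of p, j and their product. *)
Lemma imq_torsion_eq0 (p q a : R * R * R) :
  dot p p = 1 -> dot q q = 1 -> dot a a = 1 ->
  q <> p -> q <> (- p.1.1, - p.1.2, - p.2) ->
  (forall x y, torsion (imq p) x y = 0) -> (forall x y, torsion (imq q) x y = 0) ->
  forall x y, torsion (imq a) x y = 0.
Proof.
move=> pp qq aa qp qNp tp tq.
have [s [j [s0 jj pj cs1 qE]]] := gram_schmidt pp qq qp qNp.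
have PP v : imq p (imq p v) = - v by exact: imq_unit.
have JJ' v : imq j (imq j v) = - v by exact: imq_unit.
have JP v : imq j (imq p v) = - imq p (imq j v) by exact: imq_anticomm.
have PJ v : imq p (imq j v) = imq (cross p j) v by exact: imq_orthogonal.
have tpj x y : s *: torsion (imq j) x y + dot p q *: mixed (imq p) (imq j) x y = 0.
  have QE v : imq q v = dot p q *: imq p v + s *: imq j v + 0 *: imq j v.
    apply: imq_comb; rewrite [LHS]qE.
    by congr (_, _, _); rewrite mul0r addr0.
  have := tq x y; rewrite (torsion_comb brl brr (imq p) (imq j) (imq j) QE).
  rewrite tp expr0n /= addr0 cs1 subrr !mulr0 !scale0r scaler0 !addr0 !add0r.
  by rewrite expr2 (mulrC (dot p q) s) -!scalerA -scalerDr -[0 in RHS](scaler0 _ s) => /(scalerI s0).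
have [tj mpj] := torsion_mixed_eq0 brl brr PP JJ' JP s0 tp tpj.
have abc1 := etrans (cross_parseval a pp jj pj) aa.
apply: (torsion_sphere_eq0 brl brr PP JJ' JP abc1 _ tp tj mpj) => v.
by rewrite [LHS](cross_expansion I J K a pp jj pj) -PJ.
Qed.
End SphereTorsion.

(** * The space of vector fields *)

Section VectorFieldSpace.
Context {R : realType} {m : nat} (M : smoothManifold R m).
Local Notation C := (smoothfun M).
Implicit Types (X Y : vfield M) (f : C).

Lemma vfield_eq X Y : (forall p, X p = Y p) -> X = Y.
Proof.
case: X Y => X sX [Y sY] /= XY.
have E : X = Y by exact/functional_extensionality_dep.
by rewrite {}E in sX *; congr Vfield; exact: Prop_irrelevance.
Qed.

Definition zero_vfield : vfield M :=
  @Vfield _ _ M (fun=> 0) (fun=> set_mem (smoothfunP (0 : C))).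

Definition opp_vfield X : vfield M :=
  @Vfield _ _ M (fun p => - X p) (fun f => set_mem (smoothfunP (- vfield_app X f))).

Definition add_vfield X Y : vfield M :=
  @Vfield _ _ M (fun p => X p + Y p)
    (fun f => set_mem (smoothfunP (vfield_app X f + vfield_app Y f))).

Definition scale_vfield (a : R) X : vfield M :=
  @Vfield _ _ M (fun p => a *: X p)
    (fun f => set_mem (smoothfunP (a *: vfield_app X f))).

HB.instance Definition _ := gen_eqMixin (vfield M).
HB.instance Definition _ := gen_choiceMixin (vfield M).

Fact add_vfieldA : associative add_vfield.
Proof. by move=> X Y Z; apply: vfield_eq => p; exact: addrA. Qed.

Fact add_vfieldC : commutative add_vfield.
Proof. by move=> X Y; apply: vfield_eq => p; exact: addrC. Qed.

Fact add_0vfield : left_id zero_vfield add_vfield.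
Proof. by move=> X; apply: vfield_eq => p; exact: add0r. Qed.

Fact add_Nvfield : left_inverse zero_vfield opp_vfield add_vfield.
Proof. by move=> X; apply: vfield_eq => p; exact: addNr. Qed.

HB.instance Definition _ := GRing.isZmodule.Build (vfield M)
  add_vfieldA add_vfieldC add_0vfield add_Nvfield.

Fact scale_vfieldA a b X :
  scale_vfield a (scale_vfield b X) = scale_vfield (a * b) X.
Proof. by apply: vfield_eq => p; exact: scalerA. Qed.

Fact scale_1vfield : left_id 1 scale_vfield.
Proof. by move=> X; apply: vfield_eq => p; exact: scale1r. Qed.

Fact scale_vfieldDr : right_distributive scale_vfield +%R.
Proof. by move=> a X Y; apply: vfield_eq => p; exact: scalerDr. Qed.

Fact scale_vfieldDl X : {morph scale_vfield^~ X : a b / a + b}.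
Proof. by move=> a b; apply: vfield_eq => p; exact: scalerDl. Qed.

HB.instance Definition _ := GRing.Zmodule_isLmodule.Build R (vfield M)
  scale_vfieldA scale_1vfield scale_vfieldDr scale_vfieldDl.

Lemma lie_bracket_linearl Y : linear ((@lie_bracket _ _ M)^~ Y).
Proof.
move=> a X X'; apply: vfield_eq => p; apply/val_inj/funext => f.
rewrite [LHS]/= [RHS]/= /lie_bracket_at.
have -> : vfield_app (a *: X + X') f = a *: vfield_app X f + vfield_app X' f.
  exact/val_inj.
rewrite (set_mem (tangentP _)).1.
rewrite -[(a *: X + X') p _]/(a * X p _ + X' p _).
rewrite -[RHS]/(a * (X p _ - Y p _) + (X' p _ - Y p _)).
ring.
Qed.

Lemma lie_bracket_linearr X : linear (@lie_bracket _ _ M X).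
Proof.
move=> a Y Y'; apply: vfield_eq => p; apply/val_inj/funext => f.
rewrite [LHS]/= [RHS]/= /lie_bracket_at.
have -> : vfield_app (a *: Y + Y') f = a *: vfield_app Y f + vfield_app Y' f.
  exact/val_inj.
rewrite (set_mem (tangentP _)).1.
rewrite -[(a *: Y + Y') p _]/(a * Y p _ + Y' p _).
rewrite -[RHS]/(a * (X p _ - Y p _) + (X p _ - Y' p _)).
ring.
Qed.

Fact endo_app_linear (A : endo M) : linear (endo_app A).
Proof. by move=> a X Y; apply: vfield_eq => p; exact: endo_linear. Qed.

HB.instance Definition _ (A : endo M) :=
  GRing.isLinear.Build R (vfield M) (vfield M) *:%R (endo_app A) (endo_app_linear A).

HB.instance Definition _ (A : endo M) (p : M) :=
  GRing.isLinear.Build R (tangent p) (tangent p) *:%R (A p) (@endo_linear _ _ _ A p).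

(** The endomorphism field whose actions on the tangent spaces and on vector
    fields are both instances of imq. *)
Definition imendo (I J K : endo M) (u : R * R * R) : endo M :=
  u.1.1 *: I + u.1.2 *: J + u.2 *: K.

Lemma endo_app_imendo (I J K : endo M) u X :
  endo_app (imendo I J K u) X = imq (endo_app I) (endo_app J) (endo_app K) u X.
Proof. exact: vfield_eq. Qed.

Lemma nijenhuis_torsion (A : endo M) X Y p :
  nijenhuis A X Y p = torsion (@lie_bracket _ _ M) (endo_app A) X Y p.
Proof. by []. Qed.

End VectorFieldSpace.

Theorem theorem3p1 (R : realType) (n : nat) (M : smoothManifold R (4 * n)%N)
    (H : set (endo M)) (hH : almost_hypercomplex H)
    (P Q : endo M) (hP : H P) (hQ : H Q) (hPQ : P <> Q) (hPNQ : P <> - Q)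
    (iP : acs_integrable P) (iQ : acs_integrable Q) :
  forall A : endo M, H A -> acs_integrable A.
Proof.
case: hH => [I [J [K [I2 J2 K2 [IJ JI] HE]]]].
have HP (A : endo M) : H A -> exists2 u, dot u u = 1 & A = imendo M I J K u.
  by rewrite HE => -[a [b [c [abc ->]]]]; exists (a, b, c).
move=> A /HP[a aa ->].
case/HP: hP => p pp PE; case/HP: hQ => q qq QE.
rewrite {}PE {}QE in hPQ hPNQ iP iQ.
have E (B D : endo M) x v : B = D -> B x v = D x v by move=> ->.
split.
  apply: endo_eq => x v.
  apply: (@imq_unit _ _ (I x) (J x) (K x)) => // w.
  - exact: (E _ _ x w I2).
  - exact: (E _ _ x w J2).
  - exact: (E _ _ x w IJ).
  - exact: (E _ _ x w JI).
have tE u : (forall X Y x, nijenhuis (imendo M I J K u) X Y x = 0) <->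
  (forall X Y, torsion (@lie_bracket _ _ M) (imq (endo_app I) (endo_app J) (endo_app K) u) X Y = 0).
  have -> : imq (endo_app I) (endo_app J) (endo_app K) u = endo_app (imendo M I J K u).
    by apply/funext => X; rewrite endo_app_imendo.
  split=> [N X Y | T X Y x]; first exact/vfield_eq/N.
  by rewrite nijenhuis_torsion T.
apply/tE.
apply: (imq_torsion_eq0 _ _ _ _ _ _ p q a) => //.
- exact: lie_bracket_linearl.
- exact: lie_bracket_linearr.
- by move=> X; apply: vfield_eq => x; exact: (E _ _ x (X x) I2).
- by move=> X; apply: vfield_eq => x; exact: (E _ _ x (X x) J2).
- by move=> X; apply: vfield_eq => x; exact: (E _ _ x (X x) IJ).
- by move=> X; apply: vfield_eq => x; exact: (E _ _ x (X x) JI).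
- by move=> qp; apply: hPQ; rewrite qp.
- move=> qNp; apply: hPNQ; rewrite qNp /imendo /=.
  by rewrite !scaleNr -!opprD opprK.
- exact/tE/iP.2.
- exact/tE/iQ.2.
Qed.
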